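(* Every GaTEx graph is weakly-chordal and hence perfect.
   Context: All graphs are finite, simple and undirected. A galled-tree on a finite nonempty set $X$ is a directed acyclic graph $N=(V,E)$ such that either $V=X=\{x\}$ and $E=\emptyset$, or: (N1) there is a unique root with indegree 0 and outdegree at least 2; (N2) $x\in X$ iff $x$ has outdegree 0 and indegree 1; (N3) every non-root $v\in V\setminus X$ has either indegree 1 and outdegree at least 2, or indegree 2 and outdegree at least 1 (hybrid-vertex); (N4) each biconnected component $C$ of $N$ contains at most one hybrid-vertex whose two in-neighbours both belong to $C$. For $x,y\in X$, $\mathrm{lca}_N(x,y)$ is the (unique) minimal common ancestor of $x,y$. A labeled galled-tree $(N,t)$ has $t:V\to\{0,1,\odot\}$ with $t(x)=\odot$ iff $x\in X$; it explains the graph on $X$ where $\{x,y\}$ is an edge iff $t(\mathrm{lca}_N(x,y))=1$. A graph is GaTEx if it is isomorphic to a graph explained by some labeled galled-tree. A hole is an induced cycle on at least five vertices, an anti-hole is the complement of a hole; a graph is weakly-chordal if it contains neither holes nor anti-holes as induced subgraphs. A graph is perfect if for every induced subgraph the chromatic number equals the clique number. *)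

(* Defs.v *)
From HB Require Import structures.
From mathcomp Require Import all_boot.

Set Implicit Arguments.
Unset Strict Implicit.
Unset Printing Implicit Defensive.

Record sgraph := SGraph {
  svertex :> finType;
  sedge : rel svertex;
  sedge_sym : symmetric sedge;
  sedge_irr : irreflexive sedge }.

Declare Scope graph_scope.
Delimit Scope graph_scope with graph.
Notation "x -- y" := (sedge x y) (at level 30) : graph_scope.
Local Open Scope graph_scope.

Definition giso (G H : sgraph) : Prop :=
  exists f : G -> H, bijective f /\ forall x y, (f x -- f y) = (x -- y).

Section Constructions.
Variable G : sgraph.

Definition induced_edge (A : {set G}) : rel {x : G | x \in A} :=
  fun x y => val x -- val y.
Lemma induced_sym A : symmetric (@induced_edge A).
Proof. by move=> x y; exact: sedge_sym. Qed.
Lemma induced_irr A : irreflexive (@induced_edge A).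
Proof. by move=> x; exact: sedge_irr. Qed.
Definition induced (A : {set G}) : sgraph :=
  SGraph (@induced_sym A) (@induced_irr A).

Definition compl_edge : rel G := fun x y => (x != y) && ~~ (x -- y).
Lemma compl_sym : symmetric compl_edge.
Proof. by move=> x y; rewrite /compl_edge eq_sym sedge_sym. Qed.
Lemma compl_irr : irreflexive compl_edge.
Proof. by move=> x; rewrite /compl_edge eqxx. Qed.
Definition compl : sgraph := SGraph compl_sym compl_irr.

End Constructions.

Definition cycle_edge n : rel 'I_n :=
  fun i j => (i != j) && ((j == ordS i) || (i == ordS j)).
Lemma cycle_edge_sym n : symmetric (@cycle_edge n).
Proof. by move=> i j; rewrite /cycle_edge eq_sym orbC. Qed.
Lemma cycle_edge_irr n : irreflexive (@cycle_edge n).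
Proof. by move=> i; rewrite /cycle_edge eqxx. Qed.
(** The cycle on [n] vertices, meaningful for [3 <= n]. *)
Definition cycle_graph n : sgraph :=
  SGraph (@cycle_edge_sym n) (@cycle_edge_irr n).

Definition is_hole (H : sgraph) : Prop :=
  exists n, 5 <= n /\ giso H (cycle_graph n).

Definition is_antihole (H : sgraph) : Prop :=
  exists n, 5 <= n /\ giso H (compl (cycle_graph n)).

Definition weakly_chordal (G : sgraph) : Prop :=
  forall A : {set G}, ~ is_hole (induced A) /\ ~ is_antihole (induced A).

Definition clique (G : sgraph) (K : {set G}) : bool :=
  [forall x in K, forall y in K, (x != y) ==> (x -- y)].

Definition clique_number (G : sgraph) : nat :=
  \max_(K : {set G} | clique K) #|K|.

Definition colorable (G : sgraph) (k : nat) : bool :=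
  [exists f : {ffun G -> 'I_k}, forall x, forall y, (x -- y) ==> (f x != f y)].

Lemma colorable_card (G : sgraph) : exists k, colorable G k.
Proof.
exists #|G|; apply/existsP; exists [ffun x => enum_rank x].
apply/forallP=> x; apply/forallP=> y; apply/implyP=> xy; rewrite !ffunE.
by apply: contraTneq xy => /enum_rank_inj->; rewrite sedge_irr.
Qed.

Definition chromatic_number (G : sgraph) : nat := ex_minn (colorable_card G).

Definition perfect (G : sgraph) : Prop :=
  forall A : {set G}, chromatic_number (induced A) = clique_number (induced A).

(** The subgraph of [G] induced by [A] is connected (vacuous for [A = set0]). *)
Definition connected_on (G : sgraph) (A : {set G}) : bool :=
  [forall x in A, forall y in A,
     connect [rel u v : G | [&& u \in A, v \in A & u -- v]] x y].

(** Biconnected: connected, and no vertex whose removal disconnects; single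
    vertices and single edges count as biconnected. *)
Definition biconnected_on (G : sgraph) (A : {set G}) : bool :=
  [&& A != set0, connected_on A & [forall w in A, connected_on (A :\ w)]].

(** Maximal biconnected subgraphs are induced, hence given by their vertices. *)
Definition bicomponent (G : sgraph) (C : {set G}) : bool :=
  maxset (@biconnected_on G) C.

Record digraph := DiGraph { dvertex :> finType; arc : rel dvertex }.

Section Digraph.
Variable N : digraph.

Definition in_nbrs (v : N) : {set N} := [set u | arc u v].
Definition out_nbrs (v : N) : {set N} := [set u | arc v u].
Definition indeg (v : N) : nat := #|in_nbrs v|.
Definition outdeg (v : N) : nat := #|out_nbrs v|.

Definition acyclic : Prop := forall c : seq N, cycle (@arc N) c -> c = [::].

Definition underlying_edge : rel N :=
  fun u v => (u != v) && (arc u v || arc v u).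
Lemma underlying_sym : symmetric underlying_edge.
Proof. by move=> u v; rewrite /underlying_edge eq_sym orbC. Qed.
Lemma underlying_irr : irreflexive underlying_edge.
Proof. by move=> u; rewrite /underlying_edge eqxx. Qed.
Definition underlying : sgraph := SGraph underlying_sym underlying_irr.

Definition is_root (v : N) : bool := (indeg v == 0) && (1 < outdeg v).
Definition is_hybrid (v : N) : bool := (indeg v == 2) && (0 < outdeg v).

Definition N1 : Prop := exists! r : N, is_root r.

Definition N2 (X : {set N}) : Prop :=
  forall x : N, (x \in X) = (outdeg x == 0) && (indeg x == 1).

Definition N3 (X : {set N}) : Prop :=
  forall v : N, ~~ is_root v -> v \notin X ->
    ((indeg v == 1) && (1 < outdeg v)) || is_hybrid v.

Definition N4 : Prop :=
  forall C : {set N}, bicomponent (C : {set underlying}) ->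
    #|[set h in C | is_hybrid h & in_nbrs h \subset C]| <= 1.

Definition trivial_network (X : {set N}) : Prop :=
  exists x : N, [/\ [set: N] = [set x], X = [set x] &
                    forall u v : N, ~~ arc u v].

Definition galled_tree (X : {set N}) : Prop :=
  [/\ X != set0, acyclic & trivial_network X \/ [/\ N1, N2 X, N3 X & N4]].

Definition common_ancestor (x y v : N) : bool :=
  connect (@arc N) v x && connect (@arc N) v y.

Definition min_common_ancestor (x y v : N) : bool :=
  common_ancestor x y v &&
  [forall w, common_ancestor x y w && connect (@arc N) v w ==> (w == v)].

Definition is_lca (x y v : N) : bool :=
  min_common_ancestor x y v &&
  [forall w, min_common_ancestor x y w ==> (w == v)].

Lemma is_lcaC x y v : is_lca x y v = is_lca y x v.
Proof.
have cC w : common_ancestor x y w = common_ancestor y x w by apply: andbC.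
have mC w : min_common_ancestor x y w = min_common_ancestor y x w.
  by rewrite /min_common_ancestor cC; congr (_ && _);
     apply: eq_forallb => u; rewrite cC.
by rewrite /is_lca mC; congr (_ && _); apply: eq_forallb => w; rewrite mC.
Qed.

End Digraph.

Inductive label := Lab0 | Lab1 | LabLeaf. (* 0, 1, ⊙ *)

Lemma label_eq_dec (a b : label) : {a = b} + {a <> b}.
Proof. decide equality. Defined.
HB.instance Definition _ := hasDecEq.Build label (compareP label_eq_dec).

Definition labeling (N : digraph) (X : {set N}) (t : N -> label) : Prop :=
  forall x, t x = LabLeaf <-> x \in X.

Section Explained.
Variables (N : digraph) (X : {set N}) (t : N -> label).

Definition explained_edge : rel {x : N | x \in X} :=
  fun x y => (x != y) && [exists v, is_lca (val x) (val y) v && (t v == Lab1)].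
Lemma explained_sym : symmetric explained_edge.
Proof.
move=> x y; rewrite /explained_edge eq_sym; congr (_ && _).
by apply: eq_existsb => v; rewrite is_lcaC.
Qed.
Lemma explained_irr : irreflexive explained_edge.
Proof. by move=> x; rewrite /explained_edge eqxx. Qed.
Definition explained : sgraph := SGraph explained_sym explained_irr.

End Explained.

Definition GaTEx (G : sgraph) : Prop :=
  exists (N : digraph) (X : {set N}) (t : N -> label),
    [/\ galled_tree X, labeling X t & giso G (explained X t)].

(* Main.v *)
(* Call a pair [x], [y] of distinct vertices dominated if every neighbour of [x]
   other than [y] is a neighbour of [y].  If every induced subgraph on at least
   two vertices has such a pair, then the graph is perfect, by induction on the
   number of vertices, and it has no hole or anti-hole: domination is reversed
   by complementation and does not occur in a cycle of length at least five.

   In a galled-tree, say that [b] is separated by a hybrid [h] if [b] reaches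
   exactly one of the two parents of [h].  The arcs into [b] then lie on a cycle
   through [h], so by (N4) a vertex is separated by at most one hybrid.  Two
   incomparable vertices with a common descendant are separated by a common
   hybrid.  Given a set [S] of leaves, let [v] be a lowest vertex above two of
   them, [x] and [y].  It follows that, up to exchanging [x] and [y], the lca of
   [x], [z] and that of [y], [z] coincide for all [z] in [S], except when the
   latter is one fixed vertex, whose label decides which of [x], [y] is
   dominated by the other. *)
From mathcomp Require Import all_boot zify.
Require Import Defs.

Set Implicit Arguments.
Unset Strict Implicit.
Unset Printing Implicit Defensive.

Local Open Scope graph_scope.

(** * Dominated pairs and perfection *)

Definition dominated_in (G : sgraph) (A : {set G}) (x y : G) : Prop :=
  [/\ x \in A, y \in A, x != y &
      forall z, z \in A -> z != x -> z != y -> x -- z -> y -- z].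

Definition domination_hereditary (G : sgraph) : Prop :=
  forall A : {set G}, 1 < #|A| -> exists x y, dominated_in A x y.

Lemma ltn_unbump h i k : h < k -> i < k -> i != h -> unbump h i < k.-1.
Proof. by rewrite /unbump; case: (ltnP h i); lia. Qed.

Section Perfection.
Variable G : sgraph.
Implicit Types (A K T : {set G}) (f : G -> nat).

Definition proper_on A k f : Prop :=
  {in A, forall x, f x < k} /\ {in A &, forall x y, x -- y -> f x != f y}.

Lemma cliqueP K :
  reflect {in K &, forall x y, x != y -> x -- y} (clique K).
Proof.
apply: (iffP forall_inP) => [cK x y xK yK | cK x xK].
  by move/forall_inP: (cK x xK) => /(_ y yK) /implyP.
by apply/forall_inP=> y yK; apply/implyP; apply: cK.
Qed.

Lemma clique_card_proper A K k f :
  proper_on A k f -> K \subset A -> clique K -> #|K| <= k.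
Proof.
move=> [fk fP] /subsetP sKA /cliqueP cK.
have inj : {in K &, injective f}.
  move=> x y xK yK fxy; apply/eqP; apply: contraT => nxy.
  by have := fP _ _ (sKA _ xK) (sKA _ yK) (cK _ _ xK yK nxy); rewrite fxy eqxx.
have uf : uniq [seq f x | x <- enum K].
  rewrite map_inj_in_uniq ?enum_uniq // => x y.
  by rewrite !mem_enum; apply: inj.
rewrite cardE -(size_map f) -(size_iota 0 k); apply: uniq_leq_size => // i.
by case/mapP=> x; rewrite mem_enum mem_iota add0n => /sKA/fk ? ->.
Qed.

(** Induction on the size of [A], deleting the dominated vertex [x]. If [x] and [y] are not
    adjacent, [x] takes the colour of [y]. Otherwise the colour class of [y] keeps a colour of its
    own, and the rest, including [x], is recoloured by induction with [k.-1] colours. *)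
Lemma proper_on_clique_bound A k :
    domination_hereditary G ->
    (forall K, K \subset A -> clique K -> #|K| <= k) ->
  exists f, proper_on A k f.
Proof.
move=> domG; have [n] := ubnP #|A|; elim: n A k => // n IHn A k.
rewrite ltnS => ltAn bK.
case: (leqP #|A| 1) => [|/domG[x [y [xA yA nxy dom]]]].
  rewrite leq_eqVlt => /orP[/cards1P[x defA] | ].
    exists (fun=> 0); split=> [z _ | z1 z2].
      have := bK A (subxx _); rewrite defA cards1; apply.
      by apply/cliqueP=> u v; rewrite !inE => /eqP-> /eqP->; rewrite eqxx.
    by rewrite defA !inE => /eqP-> /eqP->; rewrite sedge_irr.
  rewrite ltnS leqn0 => /eqP/cards0_eq->.
  by exists (fun=> 0); split=> z; rewrite inE.
have ltAx : #|A :\ x| < n by rewrite (leq_trans _ ltAn) // [#|A|](cardsD1 x) xA.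
have [f [fk fP]] : exists f, proper_on (A :\ x) k f.
  apply: IHn => // K sK; apply: bK; exact: subset_trans sK (subD1set _ _).
have yAx : y \in A :\ x by rewrite !inE eq_sym nxy.
case xy: (x -- y); last first.
  exists (fun z => if z == x then f y else f z); split=> [z zA | z1 z2 z1A z2A].
    by case: eqP => [_|/eqP nzx]; apply: fk; rewrite // !inE nzx.
  have aux z : z \in A -> z != x -> x -- z -> f y != f z.
    move=> zA nzx xz; have nzy : z != y by apply: contraFneq xy => <-.
    by apply: fP => //; [rewrite !inE nzx | apply: dom].
  case: (eqVneq z1 x) => [->|n1]; case: (eqVneq z2 x) => [->|n2].
  - by rewrite sedge_irr.
  - exact: aux.
  - by rewrite sedge_sym eq_sym; apply: aux.
  - by apply: fP; rewrite !inE ?n1 ?n2.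
(* The colour class of [y] in [A :\ x] meets every maximum clique of [A]: a
   clique through [x] missing [y] can be extended by [y]. *)
pose T := [set z in A :\ x | f z == f y].
have yT : y \in T by rewrite inE yAx eqxx.
have sTA : T \subset A by apply/subsetP=> z; rewrite !inE => /andP[/andP[]].
have kgt0 : 0 < k by apply: leq_ltn_trans (fk y yAx).
have ltAT : #|A :\: T| < n.
  apply: leq_trans ltAn; apply: proper_card; apply/properP; split.
    exact: subsetDl.
  by exists y => //; rewrite inE yT.
have [g [gk gP]] : exists g, proper_on (A :\: T) k.-1 g.
  apply: IHn => // K sK cK.
  have sKA : K \subset A by apply: subset_trans sK (subsetDl _ _).
  have yK : y \notin K by apply: contraTN yT => /(subsetP sK); rewrite inE => /andP[].
  have [xK | xK] := boolP (x \in K).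
    rewrite -ltnS prednK //; have -> : #|K|.+1 = #|y |: K| by rewrite cardsU1 yK.
    apply: bK; first by rewrite subUset sub1set yA.
    have adjy z : z \in K -> z != y -> y -- z.
      move=> zK nzy; have [->|nzx] := eqVneq z x; first by rewrite sedge_sym.
      apply: dom => //; first exact: (subsetP sKA).
      by apply: (cliqueP _ cK) => //; rewrite eq_sym.
    apply/cliqueP=> u v; rewrite !inE => /predU1P[->|uK] /predU1P[->|vK].
    - by rewrite eqxx.
    - by rewrite eq_sym; apply: adjy.
    - by rewrite sedge_sym; apply: adjy.
    - exact: (cliqueP _ cK).
  (* A clique avoiding [x] and [T] has no vertex of colour [f y], so [f] colours it with the [k.-1]
     other colours. *)
  have sKx : K \subset A :\ x by rewrite subsetD1 sKA.
  have cyK : {in K, forall z, f z != f y}.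
    move=> z zK; case/setDP: (subsetP sK z zK) => zA; apply: contraNneq => fzy.
    by rewrite !inE zA fzy eqxx !andbT; apply: contraNneq xK => <-.
  apply: (@clique_card_proper K K _ (fun z => unbump (f y) (f z))) => //.
  split=> [z zK | z1 z2 z1K z2K z12].
    by apply: ltn_unbump; [apply: fk | apply/fk/(subsetP sKx) | apply: cyK].
  have := fP _ _ (subsetP sKx _ z1K) (subsetP sKx _ z2K) z12.
  by apply: contra_neq => /(can_in_inj (@unbumpK _)) -> //; apply: cyK.
exists (fun z => if z \in T then k.-1 else g z); split=> [z zA | z1 z2 z1A z2A e12].
  case: ifP => [_|/negbT zT]; first by rewrite prednK.
  by apply: leq_trans (leq_pred k); apply: gk; rewrite inE zT.
case: ifP => [z1T|/negbT z1T]; case: ifP => [z2T|/negbT z2T].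
- move: z1T z2T; rewrite !inE => /andP[/andP[n1 _] /eqP e1] /andP[/andP[n2 _] /eqP e2].
  by have := fP z1 z2; rewrite !inE n1 n2 z1A z2A e1 e2 eqxx => /(_ isT isT e12).
- by rewrite neq_ltn orbC gk // inE z2T.
- by rewrite neq_ltn gk // inE z1T.
- by apply: gP => //; rewrite inE ?z1T ?z2T.
Qed.

(** The clique number serves as the bound [k] above; conversely, a proper colouring is injective on
    every clique. *)
Lemma domination_hereditary_perfect : domination_hereditary G -> perfect G.
Proof.
move=> domG A; rewrite /chromatic_number; case: ex_minnP => k colk kmin.
apply/eqP; rewrite eqn_leq; apply/andP; split.
  apply: kmin.
  have [|f [fk fP]] := @proper_on_clique_bound A (clique_number (induced A)) domG.
    move=> K sKA /cliqueP cK.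
    pose K' : {set induced A} := [set u | val u \in K].
    have -> : #|K| = #|K'|.
      have -> : K = [set val u | u in K'].
        apply/setP=> z; apply/idP/imsetP => [zK | [u]]; last by rewrite inE => ? ->.
        by exists (Sub z (subsetP sKA _ zK)); rewrite ?inE.
      by rewrite card_imset //; apply: val_inj.
    rewrite /clique_number; apply: (bigmax_sup K') => //.
    apply/forall_inP=> u; rewrite inE => uK; apply/forall_inP=> v.
    by rewrite inE => vK; apply/implyP=> nuv; apply: cK.
  apply/existsP; exists [ffun u : induced A => Ordinal (fk _ (valP u))].
  apply/forallP=> u; apply/forallP=> v; apply/implyP=> uv; rewrite !ffunE.
  by apply/negP=> /eqP/(congr1 val)/= /eqP; apply/negP/fP => //; apply: valP.
apply/bigmax_leqP => K /forall_inP cK.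
case/existsP: colk => f /forallP fP.
have inj : {in K &, injective f}.
  move=> u v uK vK fuv; apply/eqP; apply: contraT => nuv.
  have /forall_inP/(_ v vK)/implyP/(_ nuv) uv := cK u uK.
  by have /forallP/(_ v)/implyP/(_ uv) := fP u; rewrite fuv eqxx.
by rewrite -(card_in_imset inj) -[k in _ <= k]card_ord max_card.
Qed.

End Perfection.

(** * Holes and anti-holes *)

Lemma val_ordS n (i : 'I_n) : val (ordS i) = if i.+1 == n then 0 else i.+1.
Proof.
rewrite /=; case: eqP => [->|ne]; first by rewrite modnn.
by rewrite modn_small //; have := ltn_ord i; lia.
Qed.

(** The wrap-around between [n.-1] and [0] is spelled out so that [lia] can decide adjacency. *)
Lemma cycle_edgeE n (i j : 'I_n) : 5 <= n ->
  cycle_edge i j = [|| j == i.+1 :> nat, i == j.+1 :> nat,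
                      (i == 0 :> nat) && (j.+1 == n) |
                      (j == 0 :> nat) && (i.+1 == n)].
Proof.
move=> n5; rewrite /cycle_edge -!(inj_eq val_inj) !val_ordS /=.
by have := ltn_ord i; have := ltn_ord j; do 2!case: ifP; lia.
Qed.

(** If [j] is adjacent to [i], the other neighbour of [i] would close a triangle with them;
    otherwise [i] and [j] would share both neighbours of [i] and close a cycle of length four. *)
Lemma cycle_not_dominated n (i j : 'I_n) : 5 <= n ->
  ~ dominated_in [set: cycle_graph n] i j.
Proof.
move=> n5 [_ _ nij dom].
(* [k1] and [k2] are the cyclic successor and predecessor of [i]. *)
have [k1 k1E] : exists k : 'I_n, val k = if i.+1 == n then 0 else i.+1.
  by exists (ordS i); rewrite val_ordS.
have [k2 k2E] : exists k : 'I_n, val k = if i == 0 :> nat then n.-1 else i.-1.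
  have lt : (if i == 0 :> nat then n.-1 else i.-1) < n.
    by have := ltn_ord i; case: ifP; lia.
  by exists (Ordinal lt).
move: (dom k1 (in_setT _)) (dom k2 (in_setT _)) nij => {dom}.
rewrite /= !cycle_edgeE // -!(inj_eq val_inj) /=.
have := ltn_ord i; have := ltn_ord j; rewrite /= in k1E k2E *; rewrite k1E k2E.
by do 2!case: ifP; lia.
Qed.

Lemma dominated_compl (G : sgraph) (A : {set G}) x y :
  dominated_in (A : {set compl G}) x y -> dominated_in A y x.
Proof.
case=> xA yA nxy dom; split=> //; first by rewrite eq_sym.
move=> z zA nzy nzx yz; apply: contraT => nxz.
have := dom z zA nzx nzy.
by rewrite /= /compl_edge yz andbF [x == z]eq_sym nzx nxz => /(_ isT).
Qed.

Lemma giso_induced_dominated (G H : sgraph) (A : {set G}) :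
    domination_hereditary G -> giso (induced A) H -> 1 < #|H| ->
  exists x y, dominated_in [set: H] x y.
Proof.
move=> domG [f [bf fE]] H1.
have [|x [y [xA yA nxy dom]]] := domG A.
  have -> : #|A| = #|[set: induced A]| by rewrite cardsT card_sig; apply: eq_card.
  by rewrite cardsT (bij_eq_card bf).
exists (f (Sub x xA)), (f (Sub y yA)); split=> //.
  by rewrite (inj_eq (bij_inj bf)) -(inj_eq val_inj).
case: bf => g fK gK z _; rewrite -[z]gK !(can_eq fK) !fE -!(inj_eq val_inj) /=.
by apply: dom; apply: valP.
Qed.

Lemma domination_hereditary_weakly_chordal (G : sgraph) :
  domination_hereditary G -> weakly_chordal G.
Proof.
move=> domG A; split=> [] [n [n5 /giso_induced_dominated iso]].
  have [|i [j /cycle_not_dominated]] := iso domG; last by apply.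
  by rewrite card_ord; lia.
have [|i [j /dominated_compl/cycle_not_dominated]] := iso domG; last by apply.
by rewrite card_ord; lia.
Qed.

(** * Biconnected vertex sets *)

Section Biconnected.
Variable G : sgraph.
Implicit Types A B : {set G}.

Let erel A := [rel u v : G | [&& u \in A, v \in A & u -- v]].

Lemma connected_onP A :
  reflect {in A &, forall x y, connect (erel A) x y} (connected_on A).
Proof.
apply: (iffP forall_inP) => [cA x y xA yA | cA x xA].
  by move/forall_inP: (cA x xA) => /(_ y yA).
by apply/forall_inP=> y yA; apply: cA.
Qed.

Lemma connected_onU A B z : z \in A -> z \in B ->
  connected_on A -> connected_on B -> connected_on (A :|: B).
Proof.
move=> zA zB /connected_onP cA /connected_onP cB.
have sub (D : {set G}) : D \subset A :|: B ->
    forall u v, connect (erel D) u v -> connect (erel (A :|: B)) u v.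
  move=> /subsetP sD u v; apply: connect_sub => {}u {}v /and3P[uD vD uv].
  by apply: connect1; rewrite /= !sD.
have toz u : u \in A :|: B ->
    connect (erel (A :|: B)) u z /\ connect (erel (A :|: B)) z u.
  case/setUP=> uD; split;
    by [apply: (sub A); rewrite ?subsetUl ?cA | apply: (sub B); rewrite ?subsetUr ?cB].
apply/connected_onP=> x y /toz[xz _] /toz[_]; exact: connect_trans.
Qed.

Lemma biconnected_onP A : biconnected_on A ->
  [/\ A != set0, connected_on A & forall w, connected_on (A :\ w)].
Proof.
case/and3P=> A0 cA /forall_inP cD; split=> // w.
by have [/cD // | wA] := boolP (w \in A);
  rewrite (setDidPl _) // disjoint_sym disjoints1.
Qed.

(** Whichever [w] is deleted, one of [x] and [y] survives and joins the two connected remainders. *)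
Lemma biconnected_onU A B x y :
    x \in A :&: B -> y \in A :&: B -> x != y ->
  biconnected_on A -> biconnected_on B -> biconnected_on (A :|: B).
Proof.
move=> /setIP[xA xB] /setIP[yA yB] nxy /biconnected_onP[A0 cA dA].
move=> /biconnected_onP[B0 cB dB]; apply/and3P; split.
- by apply/set0Pn; exists x; rewrite inE xA.
- exact: (connected_onU xA xB).
apply/forall_inP=> w _; rewrite setDUl.
have [nxw | nyw] : x != w \/ y != w.
  by case: (eqVneq x w) => [<-|]; [right; rewrite eq_sym | left].
  by apply: (@connected_onU _ _ x); rewrite ?inE ?nxw.
by apply: (@connected_onU _ _ y); rewrite ?inE ?nyw.
Qed.

Lemma connected_on_path x s :
  path (@sedge G) x s -> connected_on [set z in x :: s].
Proof.
elim: s x => [|y s IHs] x /=.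
  move=> _; apply/connected_onP=> u v; rewrite !inE => /eqP-> /eqP->.
  exact: connect0.
case/andP=> xy /IHs cs.
have -> : [set z in [:: x, y & s]] = [set x; y] :|: [set z in y :: s].
  by apply/setP=> z; rewrite !inE; case: (z == x); case: (z == y).
apply: (@connected_onU _ _ y) => //; rewrite ?inE ?eqxx ?orbT //.
have yx : y -- x by rewrite sedge_sym.
apply/connected_onP=> u v; rewrite !inE => /orP[] /eqP-> /orP[] /eqP->;
  by rewrite ?connect0 //; apply: connect1; rewrite /= !inE !eqxx ?orbT.
Qed.

(** A cycle rotated to start at the deleted vertex leaves a path. *)
Lemma biconnected_on_cycle s :
  s != [::] -> uniq s -> cycle (@sedge G) s -> biconnected_on [set z in s].
Proof.
move=> s0 us cs; apply/and3P; split.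
- by case: s s0 {us cs} => // x s _; apply/set0Pn; exists x; rewrite !inE eqxx.
- case: s cs {us s0} => [|x s] /=.
    by move=> _; apply/connected_onP=> x; rewrite inE.
  by rewrite rcons_path => /andP[/connected_on_path].
apply/forall_inP=> w; rewrite inE => /rot_to[i s' def_s].
have -> : [set z in s] = [set z in w :: s'].
  by apply/setP=> z; rewrite [LHS]inE [RHS]inE -def_s mem_rot.
have : uniq (w :: s') by rewrite -def_s rot_uniq.
have : cycle (@sedge G) (w :: s') by rewrite -def_s rot_cycle.
move=> /= cs' /andP[ws' _].
have -> : [set z in w :: s'] :\ w = [set z in s'].
  apply/setP=> z; rewrite !inE; have [->|] //= := eqVneq z w.
  by rewrite (negPf ws').
case: s' cs' {def_s ws'} => [_|y s' /=].
  by apply/connected_onP=> x; rewrite inE.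
by rewrite rcons_path => /and3P[_ /connected_on_path].
Qed.

End Biconnected.

(** * Reachability in acyclic digraphs *)

Section AcyclicDigraph.
Variable N : digraph.
Hypothesis acyN : acyclic N.

Local Notation "u ~> v" := (connect (@arc N) u v) (at level 70).

Lemma arc_irr (u : N) : arc u u = false.
Proof. by apply/negP=> uu; have := @acyN [:: u]; rewrite /= uu => /(_ isT). Qed.

Lemma connect_arc_back u w : u ~> w -> arc w u -> False.
Proof.
case/connectP=> s ps es wu.
by have := @acyN (u :: s); rewrite /= rcons_path ps -es wu => /(_ isT).
Qed.

Lemma connect_last u v : u ~> v -> u != v -> exists2 w, u ~> w & arc w v.
Proof.
case/connectP=> s ps ->; case/lastP: s ps => [|s w]; first by rewrite eqxx.
rewrite rcons_path last_rcons => /andP[ps sw] _; exists (last u s) => //.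
by apply/connectP; exists s.
Qed.

Lemma connect_antisym u v : u ~> v -> v ~> u -> u = v.
Proof.
move=> uv vu; apply/eqP; apply: contraT => nuv.
have [w uw wv] := connect_last uv nuv.
by case: (connect_arc_back (connect_trans vu uw) wv).
Qed.

(** Among the descendants of [u] satisfying [P], one with the fewest descendants is lowest. *)
Lemma connect_minimal (P : pred N) u : P u ->
  exists v, [/\ P v, u ~> v & forall w, P w -> v ~> w -> w = v].
Proof.
move=> Pu; pose Q v := P v && (u ~> v).
have Qu : Q u by rewrite /Q Pu connect0.
case: (@arg_minnP _ u Q (fun v => #|[set w | v ~> w]|) Qu) => v /andP[Pv uv] min.
exists v; split=> // w Pw vw; apply/eqP; apply: contraT => nwv.
have /min : Q w by rewrite /Q Pw (connect_trans uv vw).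
rewrite leqNgt => /negP[]; apply: proper_card; apply/properP; split.
  by apply/subsetP=> z; rewrite !inE; apply: connect_trans.
exists v; rewrite !inE ?connect0 //.
by apply: contra nwv => wv; rewrite (connect_antisym wv vw).
Qed.

Lemma connect_maximal (P : pred N) u : P u ->
  exists v, [/\ P v, v ~> u & forall w, P w -> w ~> v -> w = v].
Proof.
move=> Pu; pose Q v := P v && (v ~> u).
have Qu : Q u by rewrite /Q Pu connect0.
case: (@arg_minnP _ u Q (fun v => #|[set w | w ~> v]|) Qu) => v /andP[Pv vu] min.
exists v; split=> // w Pw wv; apply/eqP; apply: contraT => nwv.
have /min : Q w by rewrite /Q Pw (connect_trans wv vu).
rewrite leqNgt => /negP[]; apply: proper_card; apply/properP; split.
  by apply/subsetP=> z; rewrite !inE => zw; apply: connect_trans wv.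
exists v; rewrite !inE ?connect0 //.
by apply: contra nwv => vw; rewrite (connect_antisym wv vw).
Qed.

Definition incomparable u v := ~~ (u ~> v) && ~~ (v ~> u).

Definition parents (h p q : N) := [&& p != q & in_nbrs h == [set p; q]].

Lemma parents_arc h p q : parents h p q -> arc p h /\ arc q h.
Proof.
case/andP=> _ /eqP eh.
have : p \in in_nbrs h by rewrite eh !inE eqxx.
have : q \in in_nbrs h by rewrite eh !inE eqxx orbT.
by rewrite !inE.
Qed.

Definition separated b h :=
  exists p q, [/\ parents h p q, b ~> q & ~~ (b ~> p)].

Lemma underlying_arc u v : arc u v -> (u : underlying N) -- v.
Proof.
by move=> uv; rewrite /= /underlying_edge uv andbT; apply: contraTneq uv => ->;
  rewrite arc_irr.
Qed.

Lemma path_reach u s v : path (@arc N) u s -> v \in u :: s ->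
  u ~> v /\ v ~> last u s.
Proof.
move=> ps vs; split; first by apply/connectP; case/splitPl: vs ps => s1 s2 <-;
   rewrite cat_path => /andP[ps1 _]; exists s1.
case/splitPl: vs ps => s1 s2 <-; rewrite cat_path last_cat => /andP[_ ps2].
by apply/connectP; exists s2.
Qed.

Lemma path_uniq u s : path (@arc N) u s -> uniq (u :: s).
Proof.
elim: s u => //= v s IHs u /andP[uv /[dup] ps /IHs us]; rewrite us andbT.
apply/negP=> /(path_reach ps)[vu _].
by case: (connect_arc_back vu uv).
Qed.

Lemma underlying_path u s : path (@arc N) u s -> path (@sedge (underlying N)) u s.
Proof. by apply: sub_path => x y; apply: underlying_arc. Qed.

(* With [c] a lowest common ancestor of [a] and [p], the walk from [c] through
   [a -> b] down to [q], across [h], and up from [p] back to [c] is a simple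
   cycle. *)
Lemma separated_biconnected r b h p q a :
    (forall u, r ~> u) -> parents h p q -> b ~> q -> ~~ (b ~> p) -> arc a b ->
  exists2 C : {set underlying N}, biconnected_on C &
    [/\ a \in C, b \in C, h \in C & in_nbrs h \subset C].
Proof.
move=> rootr hpq bq bp ab; have [ph qh] := parents_arc hpq.
have [c [/andP[ca cp] _ minc]] :=
  @connect_minimal (fun c => (c ~> a) && (c ~> p)) r
    (introT andP (conj (rootr a) (rootr p))).
case/connectP: (ca) => s0 ps0 ea; case/connectP: (bq) => s1 ps1 eq.
case/connectP: (cp) => s2 ps2 ep.
have ps : path (@arc N) c (s0 ++ b :: s1) by rewrite cat_path ps0 -ea /= ab.
have lst : last c (s0 ++ b :: s1) = q by rewrite last_cat.
pose C : seq (underlying N) := c :: s0 ++ b :: s1 ++ h :: rev s2.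
exists [set z in C].
  apply: biconnected_on_cycle => //.
    (* The cycle is simple: [h] lies below [p] and [q], hence on none of the paths; a vertex shared
       by [s2] and [s0] is above [a] and [p], hence is [c]; one shared by [s2] and [b :: s1] would
       give a path from [b] to [p]. *)
    have eqC : perm_eq C (h :: (c :: (s0 ++ b :: s1)) ++ s2).
      have -> : C = (c :: s0 ++ b :: s1) ++ [:: h] ++ rev s2.
        by rewrite /C /= -catA.
      by rewrite perm_catCA perm_cons perm_cat2l perm_rev.
    rewrite (perm_uniq eqC) cons_uniq cat_uniq path_uniq //=.
    have := path_uniq ps2; rewrite /= => /andP[cs2 ->]; rewrite andbT.
    apply/andP; split.
      rewrite -cat_cons mem_cat; apply/negP=> /orP[hC|hs2].
        have [_] := path_reach ps hC; rewrite lst => hq.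
        by case: (connect_arc_back hq qh).
      have [|_] := @path_reach c s2 h ps2; first by rewrite inE hs2 orbT.
      by rewrite -ep => hp; case: (connect_arc_back hp ph).
    apply/hasPn => z zs2; have [|cz zp] := @path_reach c s2 z ps2.
      by rewrite inE zs2 orbT.
    rewrite -ep in zp; rewrite inE negb_or; apply/andP; split.
      by apply: contraNneq cs2 => <-.
    rewrite mem_cat; apply/negP=> /orP[zs0|zs1].
      have [|_] := @path_reach c s0 z ps0; first by rewrite inE zs0 orbT.
      rewrite -ea => za; have zc : z = c by apply: minc => //; rewrite za.
      by move: cs2; rewrite -zc zs2.
    have [bz _] := path_reach ps1 zs1.
    by case/negP: bp; apply: connect_trans zp.
  (* With the return to [c] appended, [rev s2] becomes the reversal of [c :: s2], which starts at
     [p]. *)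
  have -> : cycle (@sedge (underlying N)) C =
      path (@sedge (underlying N)) c ((s0 ++ b :: s1) ++ h :: p :: rev (belast c s2)).
    by rewrite /C /= -[p :: _]rev_rcons {1}ep -lastI rev_cons !rcons_cat /= rcons_cat -catA.
  rewrite cat_path lst; apply/and4P; split.
  - exact: underlying_path.
  - exact: underlying_arc.
  - by rewrite sedge_sym; apply: underlying_arc.
  suff : path (@sedge (underlying N)) (last c s2) (rev (belast c s2)) by rewrite -ep.
  rewrite rev_path; apply: sub_path (underlying_path ps2) => u v.
  by rewrite sedge_sym.
have inC z : (z \in [set z in C]) = (z \in C) by rewrite inE.
have hC : h \in C by rewrite !(inE, mem_cat) eqxx !orbT.
have bC : b \in C by rewrite !(inE, mem_cat) eqxx !orbT.
have aC : a \in C.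
  by rewrite /C -cat_cons mem_cat ea mem_last.
have qC : q \in C.
  have := mem_last b s1; rewrite -eq !(inE, mem_cat) => /orP[->|->];
    by rewrite !orbT.
have pC : p \in C.
  have := mem_last c s2; rewrite -ep inE => /predU1P[->|ps2'].
    by rewrite /C mem_head.
  by rewrite !(inE, mem_cat) mem_rev ps2' !orbT.
rewrite !inC; split=> //; case/andP: hpq => _ /eqP->.
by apply/subsetP=> z /set2P[] ->; rewrite inE.
Qed.
End AcyclicDigraph.

(** * Hybrids and common ancestors in galled-trees *)

Section GalledTree.
Variables (N : digraph) (X : {set N}).
Hypotheses (acyN : acyclic N) (n1 : N1 N) (n2 : N2 X) (n3 : N3 X) (n4 : N4 N).

Local Notation "u ~> v" := (connect (@arc N) u v) (at level 70).

Lemma indeg0_root (u : N) : indeg u = 0 -> is_root u.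
Proof.
move=> u0; apply: contraT => nr; have [|uX] := boolP (u \in X).
  by rewrite n2 u0 andbF.
by case/orP: (n3 nr uX) => /andP[]; rewrite u0.
Qed.

(** A highest ancestor of [u] has no in-neighbour, so it is the unique root. *)
Lemma root_reaches : exists r : N, forall u, r ~> u.
Proof.
case: n1 => r [_ ur]; exists r => u.
have [v [_ vu maxv]] := @connect_maximal N acyN predT u isT.
suff /ur-> : is_root v by [].
apply/indeg0_root/eqP; rewrite cards_eq0; apply/eqP/setP=> w; rewrite !inE.
apply/negP=> wv; have ewv := maxv w isT (connect1 wv).
by rewrite ewv arc_irr in wv.
Qed.

(** Two in-neighbours rule out a root, a leaf and a tree vertex, so (N3) leaves indegree exactly
    2. *)
Lemma parents_hybrid (h p q : N) :
  p != q -> arc p h -> arc q h -> parents h p q /\ is_hybrid h.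
Proof.
move=> npq ph qh.
have sub : [set p; q] \subset in_nbrs h.
  by apply/subsetP=> z /set2P[]->; rewrite inE.
have ge2 : 2 <= indeg h by have := subset_leq_card sub; rewrite cards2 npq.
have nr : ~~ is_root h by rewrite negb_and -lt0n ltnW.
have nX : h \notin X by rewrite n2 negb_and orbC gtn_eqF.
have hyb : is_hybrid h.
  by case/orP: (n3 nr nX) => // /andP[/eqP e1 _]; rewrite e1 in ge2.
split=> //; rewrite /parents npq eq_sym eqEcard sub cards2 npq.
by case/andP: hyb => /eqP e2 _; rewrite -/(indeg h) e2.
Qed.

(** One arc from [a] to [b] serves both hybrids: the two cycles share its ends, so their union lies
    in a single biconnected component, which by (N4) cannot contain two hybrids together with their
    parents. *)
Lemma separated_unique (b h h' : N) : separated b h -> separated b h' -> h = h'.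
Proof.
have [r rootr] := root_reaches.
move=> [p [q [hpq bq bp]]] [p' [q' [hpq' bq' bp']]].
have nrb : r != b by apply: contraNneq bp => <-.
have [a _ ab] := connect_last (rootr b) nrb.
have hyb (k k1 k2 : N) : parents k k1 k2 -> is_hybrid k.
  move=> kP; have [k1k k2k] := parents_arc kP; case/andP: kP => nk _.
  by have [] := parents_hybrid nk k1k k2k.
have [C bC [aC bC' hC sC]] := separated_biconnected acyN rootr hpq bq bp ab.
have [D bD [aD bD' hD sD]] := separated_biconnected acyN rootr hpq' bq' bp' ab.
have bCD : biconnected_on (C :|: D).
  apply: (@biconnected_onU (underlying N) C D a b) => //; try by rewrite inE ?aC ?bC'.
  by apply: contraTneq ab => ->; rewrite arc_irr.
have [M maxM sM] := maxset_exists bCD.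
apply/eqP; apply: contraT => nhh'.
have := n4 maxM; rewrite leqNgt => /negP[].
apply/card_gt1P; exists h, h'; split=> //; rewrite !inE.
  rewrite (hyb _ _ _ hpq) (subsetP sM) ?inE ?hC //=.
  by apply: subset_trans sM; apply: subset_trans sC (subsetUl _ _).
rewrite (hyb _ _ _ hpq') (subsetP sM) ?inE ?hD ?orbT //=.
by apply: subset_trans sM; apply: subset_trans sD (subsetUr _ _).
Qed.

(** Take [h] highest among the common descendants of [v] and [w] above [x]. The last vertices before
    [h] on paths from [v] and from [w] are its parents, and by maximality neither is reached from
    both. *)
Lemma incomparable_meet (v w x : N) :
    incomparable v w -> v ~> x -> w ~> x ->
  exists h p q, [/\ parents h p q, h ~> x, (v ~> q) && ~~ (v ~> p) &
                    (w ~> p) && ~~ (w ~> q)].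
Proof.
case/andP=> nvw nwv vx wx.
have [h [/andP[vh wh] hx maxh]] :=
  @connect_maximal N acyN (fun h => (v ~> h) && (w ~> h)) x
    (introT andP (conj vx wx)).
have [|q vq qh] := connect_last vh; first by apply: contraNneq nwv => ->.
have [|p wp ph] := connect_last wh; first by apply: contraNneq nvw => ->.
have notboth k : arc k h -> v ~> k -> w ~> k -> False.
  move=> kh vk wk; have ek := maxh k (introT andP (conj vk wk)) (connect1 kh).
  by rewrite ek arc_irr in kh.
have nvp : ~~ (v ~> p) by apply/negP=> vp; apply: (notboth p).
have nwq : ~~ (w ~> q) by apply/negP=> wq; apply: (notboth q).
have npq : p != q by apply: contraNneq nwq => <-.
have [hpq _] := parents_hybrid npq ph qh.
by exists h, p, q; split; rewrite ?vq ?wp.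
Qed.

(* The pair lies below a lowest vertex [v] that is above two elements of [S].
   A common ancestor of [x] and [z] not above [y] lies on the side opposite to
   [v] of the cycle of a hybrid [h] above [x], and then the common ancestors of
   [y] and [z] are those of [v] and of the other parent [p] of [h]. *)
Lemma common_ancestor_dichotomy (S : {set N}) : 1 < #|S| ->
  exists x y (c : pred N), [/\ x \in S, y \in S, x != y &
    forall z, z \in S -> z != x -> z != y ->
      common_ancestor x z =1 common_ancestor y z \/ common_ancestor y z =1 c].
Proof.
move=> S1; have [r rootr] := root_reaches.
pose D v := [set s in S | v ~> s].
have Dr : 1 < #|D r|.
  by have -> // : D r = S by apply/setP=> s; rewrite inE rootr andbT.
have [v [Dv _ minv]] := @connect_minimal N acyN (fun v => 1 < #|D v|) r Dr.
(* By minimality of [v], a vertex strictly below [v] is above at most one element of [S]. *)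
have low w s s' : v ~> w -> w != v ->
    s \in S -> s' \in S -> w ~> s -> w ~> s' -> s = s'.
  move=> vw nwv sS s'S ws ws'; apply/eqP; apply: contraT => nss'.
  case/eqP: nwv; apply: minv => //.
  by apply/card_gt1P; exists s, s'; split; rewrite // inE ?sS ?s'S.
(* An element escapes if it can be reached from a vertex incomparable to [v]. *)
pose escapes s := [exists w, incomparable v w && (w ~> s)].
have esc_sep s : v ~> s -> escapes s ->
    exists h p q, [/\ parents h p q, h ~> s, v ~> q & ~~ (v ~> p)].
  move=> vs /existsP[w /andP[inc ws]].
  have [h [p [q [hpq hs /andP[vq nvp] _]]]] := incomparable_meet inc vs ws.
  by exists h, p, q.
have strict h p q : parents h p q -> v ~> q -> v ~> h /\ h != v.
  move=> /parents_arc[_ qh] vq; split; first exact: connect_trans (connect1 qh).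
  by apply/eqP=> ehv; rewrite ehv in qh;
    case: (connect_arc_back acyN vq qh).
(* At most one element of [S] below [v] escapes: two would lie below the one hybrid separating [v],
   against [low]. So [y] can be chosen not to escape. *)
have [x [y [xS yS nxy vx [vy nescy]]]] :
    exists x y, [/\ x \in S, y \in S, x != y, v ~> x & v ~> y /\ ~~ escapes y].
  case/card_gt1P: Dv => x [y []]; rewrite !inE => /andP[xS vx] /andP[yS vy] nxy.
  have [ey | ney] := boolP (escapes y); last by exists x, y.
  have [ex | nex] := boolP (escapes x); last by exists y, x; rewrite eq_sym.
  have [h [p [q [hpq hx vq nvp]]]] := esc_sep _ vx ex.
  have [h' [p' [q' [hpq' hy vq' nvp']]]] := esc_sep _ vy ey.
  have eh : h = h'.
    by apply: (@separated_unique v); [exists p, q | exists p', q'].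
  have [vh nhv] := strict _ _ _ hpq vq.
  by case/eqP: nxy; apply: (low h) => //; rewrite eh.
(* A vertex above [y] and [z] is neither strictly below [v], by [low], nor incomparable to it, as
   [y] does not escape. *)
have CAy u z : z \in S -> z != y -> u ~> y -> u ~> z -> u ~> v.
  move=> zS nzy uy uz; apply: contraT => nuv.
  have [vu | nvu] := boolP (v ~> u).
    case/eqP: nzy; apply: (low u) => //.
    by apply: contraNneq nuv => ->; apply: connect0.
  by case/existsP: nescy; exists u; rewrite uy /incomparable nvu nuv.
have CAyx z : z \in S -> z != y ->
    forall u, common_ancestor y z u -> common_ancestor x z u.
  move=> zS nzy u /andP[uy uz]; apply/andP; split=> //.
  exact: connect_trans (CAy _ _ zS nzy uy uz) vx.
have inc_of w z : z \in S -> z != x -> common_ancestor x z w ->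
    ~~ common_ancestor y z w -> incomparable v w.
  move=> zS nzx /andP[wx wz]; rewrite /common_ancestor wz andbT => nwy.
  have nwv : ~~ (w ~> v) by apply: contra nwy => wv; apply: connect_trans vy.
  rewrite /incomparable nwv andbT; apply/negP=> vw.
  case/eqP: nzx; apply: (low w) => //.
  by apply: contraNneq nwv => ->; apply: connect0.
have [ex | nex] := boolP (escapes x); last first.
  (* The first alternative always holds here, so [pred0] is a mere placeholder. *)
  exists x, y, pred0; split=> // z zS nzx nzy; left=> w.
  apply/idP/idP; last exact: CAyx.
  move=> cw; apply: contraT => ncw; case/existsP: nex; exists w.
  by rewrite (inc_of w z) //; case/andP: cw.
have [h [p [q [hpq hx vq nvp]]]] := esc_sep _ vx ex.
have [vh nhv] := strict _ _ _ hpq vq.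
have [ph qh] := parents_arc hpq.
exists x, y, (fun u => (u ~> v) && (u ~> p)); split=> // z zS nzx nzy.
have [sub | ] := boolP [forall w, common_ancestor x z w ==> common_ancestor y z w].
  left=> w; apply/idP/idP; last exact: CAyx.
  by apply/implyP/(forallP sub).
rewrite negb_forall => /existsP[w]; rewrite negb_imply => /andP[cw ncw]; right=> u.
have inc := inc_of w z zS nzx cw ncw; case/andP: cw => wx wz.
have uniq_h k : separated v k -> k = h.
  by move=> vk; apply: (separated_unique vk); exists p, q.
(* By uniqueness [v] and [w] meet at [h] above [x]; as [v] reaches [q], the parent reached by [w] is
   [p]. *)
have wp : w ~> p.
  have [k [p' [q' [kpq _ /andP[vq' nvp'] /andP[wp' _]]]]] :=
    incomparable_meet inc vx wx.
  have ek : k = h by apply: uniq_h; exists p', q'.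
  rewrite ek in kpq; have [p'h _] := parents_arc kpq.
  have : p' \in in_nbrs h by rewrite inE.
  case/andP: hpq => _ /eqP-> /set2P[] ep; first by rewrite -ep.
  by rewrite ep vq in nvp'.
have [nvw nwv] := andP inc.
(* [h] separates [w] too, with the parents exchanged, so it is the only hybrid doing so. *)
have sep_w k p' q' : parents k p' q' -> w ~> q' -> ~~ (w ~> p') -> k = h.
  move=> kpq wq' nwp'; apply: (@separated_unique w); first by exists p', q'.
  have [k' [p1 [q1 [kpq1 _ /andP[vq1 nvp1] /andP[wp1 nwq1]]]]] :=
    incomparable_meet inc vx wx.
  have <- : k' = h by apply: uniq_h; exists p1, q1.
  exists q1, p1; split=> //; case/andP: kpq1 => n1' /eqP e1.
  by rewrite /parents eq_sym n1' e1 setUC eqxx.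
(* If [u] and [w] were incomparable, they would meet above [s] at a hybrid separating [w], which is
   [h]. *)
have uw_cmp s : u ~> v -> u ~> s -> w ~> s -> ~~ (h ~> s) -> u ~> w.
  move=> uv us ws nhs; apply: contraT => nuw.
  have nwu : ~~ (w ~> u) by apply: contra nwv => wu; apply: connect_trans uv.
  have inc' : incomparable u w by rewrite /incomparable nuw.
  have [k [q' [p' [kpq ks _ /andP[wp' nwq']]]]] := incomparable_meet inc' us ws.
  have ek : k = h.
    apply: (sep_w k p' q') => //; case/andP: kpq => n1' /eqP e1.
    by rewrite /parents eq_sym n1' e1 setUC eqxx.
  by rewrite ek (negPf nhs) in ks.
(* [uw_cmp] is applied with [s] equal to [z] in one direction and to [p] in the other. *)
apply/idP/andP => [/andP[uy uz] | [uv up]].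
  have uv := CAy _ _ zS nzy uy uz; split=> //.
  apply: connect_trans wp; apply: (uw_cmp z) => //.
  by apply/negP=> hz; case/eqP: nzx; apply: (low h).
apply/andP; split; first exact: connect_trans uv vy.
apply: connect_trans wz; apply: (uw_cmp p) => //.
by apply/negP=> hp; case: (connect_arc_back acyN hp ph).
Qed.

End GalledTree.

(** * From common ancestors to adjacency *)

Section Labels.
Variables (N : digraph) (t : N -> label).

(** Adjacency depends on the two leaves only through their set of common ancestors; an arbitrary
    predicate is allowed so that the exceptional [c] of the dichotomy also has a value. *)
Definition lca_edge (c : pred N) : bool :=
  let minc v := c v && [forall w, c w && connect (@arc N) v w ==> (w == v)] in
  [exists v, minc v && [forall w, minc w ==> (w == v)] && (t v == Lab1)].

Lemma explained_edgeE (X : {set N}) (x y : explained X t) :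
  (x -- y : bool) = (x != y) && lca_edge (common_ancestor (val x) (val y)).
Proof. by []. Qed.

Lemma eq_lca_edge (c d : pred N) : c =1 d -> lca_edge c = lca_edge d.
Proof.
move=> cd; apply: eq_existsb => v.
have emin u : c u && [forall w, c w && connect (@arc N) u w ==> (w == u)] =
              d u && [forall w, d w && connect (@arc N) u w ==> (w == u)].
  by rewrite cd; congr (_ && _); apply: eq_forallb => w; rewrite cd.
by rewrite /= emin; do 2!congr (_ && _); apply: eq_forallb => w; rewrite emin.
Qed.

End Labels.

Lemma explained_domination (N : digraph) (X : {set N}) (t : N -> label) :
  galled_tree X -> domination_hereditary (explained X t).
Proof.
case=> _ acyN NX A A1; pose S := [set val u | u in A].
have S1 : 1 < #|S| by rewrite card_imset //; apply: val_inj.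
case: NX => [[x0 [_ defX _]] | [n1 n2 n3 n4]].
  case/card_gt1P: A1 => u [v [_ _ /eqP[]]]; apply: val_inj.
  have eqx0 z : z \in X -> z = x0 by rewrite defX => /set1P.
  by rewrite (eqx0 _ (valP u)) (eqx0 _ (valP v)).
have [_ [_ [c [/imsetP[x xA ->] /imsetP[y yA ->]]]]] :=
  common_ancestor_dichotomy acyN n1 n2 n3 n4 S1.
rewrite (inj_eq val_inj) => nxy dich.
have dichE z : z \in A -> z != x -> z != y ->
    @sedge (explained X t) x z = @sedge (explained X t) y z \/
    @sedge (explained X t) y z = lca_edge t c.
  move=> zA nzx nzy; rewrite !explained_edgeE ![_ == z]eq_sym nzx nzy /=.
  have [|||/eq_lca_edge->|/eq_lca_edge->] := dich (val z).
  - exact: imset_f.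
  - by rewrite (inj_eq val_inj).
  - by rewrite (inj_eq val_inj).
  - by left.
  - by right.
(* In the exceptional case [y -- z] has the constant value [lca_edge t c]: if true, [y] dominates
   [x]; if false, [x] dominates [y]. *)
case cE: (lca_edge t c) in dichE.
  by exists x, y; split=> // z zA nzx nzy; case: (dichE z zA nzx nzy) => ->.
exists y, x; split=> //; first by rewrite eq_sym.
by move=> z zA nzy nzx; case: (dichE z zA nzx nzy) => ->.
Qed.

Lemma giso_domination (G H : sgraph) :
  giso G H -> domination_hereditary H -> domination_hereditary G.
Proof.
move=> [f [/bij_inj injf fE]] domH A A1.
have [|_ [_ [/imsetP[x xA ->] /imsetP[y yA ->] nxy dom]]] := domH (f @: A).
  by rewrite card_imset.
rewrite (inj_eq injf) in nxy; exists x, y; split=> // z zA nzx nzy.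
by rewrite -!fE; apply: dom; rewrite ?(inj_eq injf) // imset_f.
Qed.

Theorem mainTheorem6 (G : sgraph) (hG : GaTEx G) :
  weakly_chordal G /\ perfect G.
Proof.
case: hG => [N [X [t [galled _ isoG]]]].
have domG := giso_domination isoG (explained_domination galled).
split; first exact: domination_hereditary_weakly_chordal.
exact: domination_hereditary_perfect.
Qed.
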